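(* Let $X,Y,Z$ be locally convex Hausdorff topological vector spaces, $K\subset Y$ a proper closed convex cone with $\operatorname{int}K\neq\emptyset$, and $S\subset Z$ a nonempty convex cone. Let $\Phi\colon X\times Z\to Y^\infty$ be a proper $K$-convex mapping with $0_Z\in\pi(\operatorname{dom}\Phi)$, where $\pi(x,z)=z$, and let $Z_0=\operatorname{lin}(\pi(\operatorname{dom}\Phi))$. (1) Suppose that for every $L\in\mathcal L(X,Y)$ there exist $y_L\in Y$ and a neighborhood $V_L$ of $0_Z$ in $Z$ such that for every $z\in V_L\cap Z_0$ there is $x\in X$ with $\Phi(x,z)-L(x)\leqq_K y_L$. Then $$\operatorname{epi}\Phi(\cdot,0_Z)^*=\bigcup_{T\in\mathcal L_\Phi}\operatorname{epi}\Phi^*(\cdot,T).$$ (2) If, in addition, there exists $\tilde x\in X$ with $(\tilde x,0_Z)\in\operatorname{dom}\Phi$ and $\Phi(\tilde x,z)\leqq_K\Phi(\tilde x,0_Z)$ for all $z\in -S$, then $$\operatorname{epi}\Phi(\cdot,0_Z)^*=\bigcup_{T\in\mathcal L_\Phi}\operatorname{epi}\Phi^*(\cdot,T)=\bigcup_{T\in\mathcal L_\Phi^+}\operatorname{epi}\Phi^*(\cdot,T).$$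
   Context: Ordering: $K$ proper means $K\ne Y$. $y_1\leqq_K y_2$ iff $y_1-y_2\in-K$; $y_1<_K y_2$ iff $y_1-y_2\in-\operatorname{int}K$. $Y^\infty=Y\cup\{+\infty_Y\}$, $Y^\bullet=Y\cup\{-\infty_Y,+\infty_Y\}$, where $-\infty_Y<_K y<_K+\infty_Y$ for $y\in Y$, $-\infty_Y<_K+\infty_Y$, $-(+\infty_Y)=-\infty_Y$, $y+(\pm\infty_Y)=\pm\infty_Y$ for $y\in Y$; in particular $+\infty_Y\not\leqq_K y$ for $y\in Y$. Weak supremum: for $M\subset Y^\bullet$, $\operatorname{WSup}M$ is the set of $\bar v\in Y^\bullet$ such that $\bar v\not<_K v$ for all $v\in M$ and for every $\tilde v\in Y^\bullet$ with $\tilde v<_K\bar v$ there is $v\in M$ with $\tilde v<_K v$. $\mathcal L(X,Y)$ is the space of continuous linear maps $X\to Y$. For $\Phi\colon X\times Z\to Y^\infty$: $\operatorname{dom}\Phi=\{(x,z):\Phi(x,z)\neq+\infty_Y\}$; $\Phi$ is proper if $\operatorname{dom}\Phi\ne\emptyset$; $\Phi$ is $K$-convex if $\{(x,z,y)\in X\times Z\times Y:y\in\Phi(x,z)+K\}$ is convex. Conjugates: $\Phi^*(L,T)=\operatorname{WSup}\{L(x)+T(z)-\Phi(x,z):(x,z)\in X\times Z\}$ for $(L,T)\in\mathcal L(X,Y)\times\mathcal L(Z,Y)$; $\Phi(\cdot,0_Z)^*(L)=\operatorname{WSup}\{L(x)-\Phi(x,0_Z):x\in X\}$. $\operatorname{epi}\Phi(\cdot,0_Z)^*=\{(L,y)\in\mathcal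 L(X,Y)\times Y:y\in\Phi(\cdot,0_Z)^*(L)+K\}$ and $\operatorname{epi}\Phi^*(\cdot,T)=\{(L,y)\in\mathcal L(X,Y)\times Y:y\in\Phi^*(L,T)+K\}$ (where $\{\pm\infty_Y\}+K=\{\pm\infty_Y\}$). $\mathcal L_\Phi=\{T\in\mathcal L(Z,Y):\exists L\in\mathcal L(X,Y),\ \Phi^*(L,T)\neq\{+\infty_Y\}\}$, $\mathcal L_+(S,K)=\{T\in\mathcal L(Z,Y):T(S)\subset K\}$, $\mathcal L_\Phi^+=\mathcal L_\Phi\cap\mathcal L_+(S,K)$. $\operatorname{lin}$ denotes linear hull. *)

(* Defs.v *)
From HB Require Import structures.
From mathcomp Require Import all_boot all_order all_algebra.
From mathcomp Require Import all_classical all_reals all_analysis.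
Import Order.TTheory GRing.Theory Num.Theory.
Import numFieldNormedType.Exports.

Set Implicit Arguments.
Unset Strict Implicit.
Unset Printing Implicit Defensive.

Local Open Scope classical_set_scope.
Local Open Scope ring_scope.

(* The space L(X, Y) of continuous linear maps, without topology. *)
#[short(type="contLinearType")]
HB.structure Definition ContLinear (R : realType) (X Y : tvsType R) :=
  {f of @isContinuous X Y f & @GRing.Linear R X Y *:%R f}.

(* Scaling by 0 is not required, so that a cone may or may not contain 0. *)
Definition cone (R : realType) (E : lmodType R) (A : set E) :=
  forall (t : R) (x : E), 0 < t -> A x -> A (t *: x).

Definition convex_cone (R : realType) (E : lmodType R) (A : set E) :=
  cone A /\ convex_set A.

Definition lin (R : realType) (E : lmodType R) (A : set E) : set E :=
  smallest [set W : set E | submod_closed (mem W)] A.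

(* \bar Y, with the library's adde and oppe, is Y with -oo and +oo adjoined. Its
   order is not the library's: leK and ltK depend on K. The value chosen by adde
   for (-oo) + (+oo) plays no role below. A map into Y with only +oo adjoined is
   a map into \bar Y that never takes the value -oo. *)
Section order.
Context (R : realType) (Y : tvsType R) (K : set Y).

Definition leK (u v : \bar Y) : Prop :=
  match u, v with
  | y1%:E, y2%:E => (-%R @` K) (y1 - y2)
  | -oo%E, _ => True
  | _, +oo%E => True
  | _, _ => False
  end.

Definition ltK (u v : \bar Y) : Prop :=
  match u, v with
  | y1%:E, y2%:E => (-%R @` interior K) (y1 - y2)
  | -oo%E, _%:E => True
  | -oo%E, +oo%E => True
  | _%:E, +oo%E => True
  | _, _ => False
  end.

Definition WSup (M : set (\bar Y)) : set (\bar Y) :=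
  [set v | (forall w, M w -> ~ ltK v w) /\
           (forall u, ltK u v -> exists2 w, M w & ltK u w)].

(* M + K, where an infinite element of M absorbs the elements of K. *)
Definition addK (M : set (\bar Y)) : set (\bar Y) :=
  [set (v + k%:E)%E | v in M & k in K].

End order.

Section conjugate.
Context (R : realType) (X Y Z : tvsType R) (K : set Y).

Definition effdom (T : Type) (f : T -> \bar Y) : set T :=
  [set t | f t <> +oo%E].

Definition proper_fun (T : Type) (f : T -> \bar Y) := effdom f !=set0.

Definition K_convex (Phi : X * Z -> \bar Y) :=
  convex_set
    [set p : X * Z * Y | addK K [set Phi (p.1.1, p.1.2)] (p.2)%:E].

Definition weak_conj (f : X -> \bar Y) (L : contLinearType X Y) : set (\bar Y) :=
  WSup K (range (fun x : X => ((L x)%:E - f x)%E)).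

Definition weak_conj2 (Phi : X * Z -> \bar Y)
    (L : contLinearType X Y) (T : contLinearType Z Y) : set (\bar Y) :=
  WSup K (range (fun p : X * Z => ((L p.1)%:E + (T p.2)%:E - Phi p)%E)).

Definition epi (F : contLinearType X Y -> set (\bar Y)) :
    set (contLinearType X Y * Y) :=
  [set p | addK K (F p.1) (p.2)%:E].

Definition L_Phi (Phi : X * Z -> \bar Y) : set (contLinearType Z Y) :=
  [set T | exists L : contLinearType X Y, weak_conj2 Phi L T <> [set +oo%E]].

Definition L_plus (S : set Z) : set (contLinearType Z Y) :=
  [set T | T @` S `<=` K].

Definition L_Phi_plus (Phi : X * Z -> \bar Y) (S : set Z) : set (contLinearType Z Y) :=
  L_Phi Phi `&` L_plus S.

End conjugate.

(* Main.v *)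
(* A pair [(L, y)] lies in the epigraph of a weak conjugate iff no value of the
   function has [L x - f x - y] in the interior of [K], so the inclusion from
   right to left is the restriction to [z = 0]. Conversely, fix [e] interior to
   [K]; the set of [(z, r)] such that [L x + r *: e - Phi (x, z) - y] is in [K]
   for some [x] is convex and meets [{0} * R] only where [r >= 0], and the
   hypothesis on [yL] bounds it from above near [0] in [lin]. By Hahn-Banach a
   continuous linear form [l] lies below it, and [T z = l z *: e] is the
   required operator. In the second part this set contains [(- t *: s, c)] for
   a fixed [c] and all [t > 0], which forces [l >= 0] on [S]. *)
From HB Require Import structures.
Require Import Defs.
From mathcomp Require Import all_boot all_order all_algebra.
From mathcomp Require Import all_classical all_reals all_analysis.
From mathcomp Require Import lra.
Import Order.TTheory GRing.Theory Num.Theory.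
Import numFieldNormedType.Exports.

Set Implicit Arguments.
Unset Strict Implicit.
Unset Printing Implicit Defensive.

Local Open Scope classical_set_scope.
Local Open Scope ring_scope.

(** * Algebraic Hahn-Banach theorem through maximal cones *)

Section hahn_banach.
Context (R : realType) (E : lmodType R).

(** Stands for the epigraph of the sublinear functional [z |-> inf {s | B (z, s)}]; the last
    condition keeps it from being negative at [0]. *)
Definition nonneg_cone (B : set (E * R)) :=
  [/\ B (0, 0),
      forall x y s t, B (x, s) -> B (y, t) -> B (x + y, s + t),
      forall a x s, 0 < a -> B (x, s) -> B (a *: x, a * s) &
      forall s, B (0, s) -> 0 <= s].

(** Zorn's lemma: two points of the union of a chain already lie in one member, so each condition
    passes to the union. *)
Lemma maximal_nonneg_cone (G : set (E * R)) : nonneg_cone G ->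
  exists M, [/\ nonneg_cone M, G `<=` M &
    forall B, nonneg_cone B -> M `<=` B -> B `<=` M].
Proof.
move=> coneG.
(* [set0] is allowed only so that the empty chain has an upper bound *)
pose P := [set B : set (E * R) | B = set0 \/ (nonneg_cone B /\ G `<=` B)].
have [F FP Ftot|M [PM maxM]] := @Zorn_bigcup _ P.
  have [[X [FX X0]]|F0] := pselect (exists X, F X /\ X !=set0); last first.
    left; apply/seteqP; split=> // p [X FX Xp].
    by apply: F0; exists X; split=> //; exists p.
  have ne Y p : F Y -> Y p -> nonneg_cone Y /\ G `<=` Y.
    by move=> FY Yp; have [Y0|//] := FP _ FY; rewrite Y0 in Yp.
  have two p q : (\bigcup_(Y in F) Y) p -> (\bigcup_(Y in F) Y) q ->
      exists Y, [/\ F Y, Y p & Y q].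
    move=> [Y FY Yp] [Y' FY' Yq]; have [YY'|Y'Y] := Ftot _ _ FY FY'.
      by exists Y'; split=> //; exact: YY'.
    by exists Y; split=> //; exact: Y'Y.
  case: X0 => p0 Xp0; have [[X00 _ _ _] GX] := ne _ _ FX Xp0.
  right; split; last by move=> p Gp; exists X => //; exact: GX.
  split; first by exists X.
  - move=> x y s t xs yt; have [Y [FY Yx Yy]] := two _ _ xs yt.
    by exists Y => //; have [[_ + _ _] _] := ne _ _ FY Yx; exact.
  - move=> a x s a0 [Y FY Yx]; exists Y => //.
    by have [[_ _ + _] _] := ne _ _ FY Yx; exact.
  - by move=> s [Y FY Yx]; have [[_ _ _ +] _] := ne _ _ FY Yx; exact.
have G00 : G (0, 0) by case: coneG.
have [M0|[coneM GM]] := PM.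
  have nPG : ~ P G.
    by apply: maxM; rewrite M0; split=> [|G0]; [exact: sub0set|exact: (G0 _ G00)].
  by exfalso; apply: nPG; right; split.
exists M; split=> // B coneB MB p Bp; apply: contrapT => Mp.
have nPB : ~ P B by apply: maxM; split=> // BM; exact/Mp/BM.
by apply: nPB; right; split=> // q /GM /MB.
Qed.

(* At a maximal cone [M], the functional [z |-> inf {s | M (z, s)}] is odd:
   [(- z, - l z)] can be adjoined to [M] without producing a [(0, s)] with
   [s < 0]. *)
Lemma nonneg_cone_minorant (G : set (E * R)) : nonneg_cone G ->
    (forall z, exists s, G (z, s)) ->
  exists l : E -> R, scalar l /\ forall z s, G (z, s) -> l z <= s.
Proof.
move=> coneG fullG.
have [M [[M0 MD MZ Mpos] GM maxM]] := @maximal_nonneg_cone G coneG.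
pose P z := [set s | M (z, s)].
pose l z := inf (P z).
have P0 z : P z !=set0 by have [s /GM] := fullG z; exists s.
(* A point over [z] plus a point over [- z] lies over [0], where heights are nonnegative. *)
have Plb z : has_lbound (P z).
  have [s' Ms'] := P0 (- z); exists (- s') => s Ms.
  by rewrite lerNl -subr_ge0 opprK; apply: Mpos; rewrite -(addNr z); exact: MD.
have l_le z s : M (z, s) -> l z <= s by move=> Ms; exact: ge_inf.
have le_l z r : (forall s, M (z, s) -> r <= s) -> r <= l z.
  by move=> h; apply: lb_le_inf => // s; exact: h.
have lD x y : l (x + y) <= l x + l y.
  rewrite -lerBlDr; apply: (le_l _ _) => s xs.
  rewrite lerBlDr -lerBlDl; apply: (le_l _ _) => t yt.
  by rewrite lerBlDl; apply/l_le/MD.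
have lZ1 a x : 0 < a -> l (a *: x) <= a * l x.
  move=> a0; rewrite -ler_pdivrMl//; apply: (le_l _ _) => s xs.
  by rewrite ler_pdivrMl//; apply/l_le/MZ.
have lZ a x : 0 < a -> l (a *: x) = a * l x.
  move=> a0; apply/eqP; rewrite eq_le lZ1//= -ler_pdivlMl//.
  rewrite -{1}[x]scale1r -(mulVf (lt0r_neq0 a0)) -scalerA lZ1// invr_gt0//.
have l0 : l 0 = 0 by apply/eqP; rewrite eq_le l_le//= le_l.
have lN z : l (- z) = - l z.
  apply/eqP; rewrite eq_le; apply/andP; split; last first.
    by rewrite -subr_ge0 opprK addrC -l0 -{1}(subrr z) lD.
  apply: (l_le _ _).
  pose B := [set p : E * R | exists x s a, [/\ M (x, s), 0 <= a &
    p = (x - a *: z, s - a * l z)]].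
  have MB : M `<=` B.
    by move=> [x s] Mx; exists x, s, 0; rewrite scale0r mul0r !subr0.
  have coneB : nonneg_cone B.
    split; first exact: MB.
    - move=> _ _ _ _ [x [s [a [xs a0 [-> ->]]]]] [y [t [b [yt b0 [-> ->]]]]].
      exists (x + y), (s + t), (a + b); split; [exact: MD|exact: addr_ge0|].
      by congr pair; rewrite ?scalerDl ?mulrDl opprD addrACA.
    - move=> c _ _ c0 [x [s [a [xs a0 [-> ->]]]]].
      exists (c *: x), (c * s), (c * a); split; [exact: MZ| |].
        by rewrite mulr_ge0// ltW.
      by rewrite scalerBr mulrBr scalerA mulrA.
    (* A point of [B] over [0] has [x = a *: z], and then [s >= l x = a * l z]. *)
    - move=> _ [x [s [a [xs a0 [/eqP + ->]]]]].
      rewrite eq_sym subr_eq0 => /eqP xE; subst x.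
      move: a0; rewrite le_eqVlt => /predU1P[a0|a0].
        by move: xs; rewrite -a0 scale0r mul0r subr0; exact: Mpos.
      by rewrite subr_ge0 -lZ//; exact: l_le.
  apply: (maxM _ coneB MB); exists 0, 0, 1.
  by rewrite scale1r mul1r !sub0r.
exists l; split; last by move=> z s /GM; exact: l_le.
(* Since [l] is odd, subadditivity at [- x] and [- y] gives superadditivity. *)
have lDE x y : l (x + y) = l x + l y.
  by apply/eqP; rewrite eq_le lD/= -lerN2 -lN !opprD -!lN lD.
move=> a x y; rewrite lDE; congr (_ + _).
have [a0|a0|<-] := ltgtP 0 a; last by rewrite scale0r mul0r l0.
  exact: lZ.
by rewrite -{1}[a]opprK scaleNr lN lZ ?oppr_gt0// mulNr opprK.
Qed.

End hahn_banach.

(** * Interior points of convex cones *)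

Section convex_cone.
Context (R : realType).

Lemma convex_setP (E : lmodType R) (A : set E) : convex_set A <->
  forall (a b : R) x y, 0 <= a -> 0 <= b -> a + b = 1 -> A x -> A y ->
    A (a *: x + b *: y).
Proof.
split=> [cA a b x y a0 b0 ab1 Ax Ay|cA x y l /set_mem Ax /set_mem Ay].
  have a1 : 0 <= a <= 1 by rewrite a0 -ab1 lerDl.
  have := cA x y (Itv01 (proj1 (andP a1)) (proj2 (andP a1))).
  rewrite !inE => /(_ Ax Ay).
  suff -> : b = 1 - a by [].
  by rewrite -ab1 addrC addKr.
apply/mem_set/(cA _ _ x y) => //.
  by rewrite subr_ge0.
by rewrite addrC subrK.
Qed.

Lemma convex_coneD (E : lmodType R) (A : set E) : convex_cone A ->
  forall x y, A x -> A y -> A (x + y).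
Proof.
move=> [coneA /convex_setP cA] x y Ax Ay.
have -> : x + y = 2 *: (2^-1 *: x + 2^-1 *: y).
  by rewrite scalerDr !scalerA divff ?scale1r.
by apply: coneA => //; apply: cA => //; lra.
Qed.

Context (Y : tvsType R) (K : set Y) (K_cone : convex_cone K).

(** The translate [y + K] is a neighborhood of [y + x] and lies in [K]. *)
Lemma interior_coneD x y : interior K x -> K y -> interior K (y + x).
Proof.
move=> /(nbhsB y) Kx Ky; apply: filterS Kx => _ [z Kz <-].
exact: convex_coneD.
Qed.

Lemma interior_coneZ t x : 0 < t -> interior K x -> interior K (t *: x).
Proof.
move=> t0 /(nbhsZ (lt0r_neq0 t0)) Kx; apply: filterS Kx => _ [z Kz <-].
by case: K_cone => coneK _; exact: coneK.
Qed.

(** Continuity of [t |-> x - t *: y] at [0]. This is the source of the strict slack used in the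
    later contradictions. *)
Lemma interior_ray x y : interior K x ->
  exists2 t, 0 < t & interior K (x - t *: y).
Proof.
move=> Kx.
have cont : (x - t *: y) @[t --> (0 : R^o)] --> x.
  rewrite -[X in _ --> X]subr0 -(scale0r y).
  apply: (@continuous2_cvg _ _ _ _ _ _ _ _ (fun u v : Y => u - v)).
  - exact: (@sub_continuous Y (x, 0 *: y)).
  - exact: cvg_cst.
  - apply: (@continuous2_cvg _ _ _ _ _ _ _ _ (fun (u : R^o) (v : Y) => u *: v)).
    + exact: (@scale_continuous R Y (0, y)).
    + exact: cvg_id.
    + exact: cvg_cst.
have : \forall t \near (0 : R^o), interior K (x - t *: y).
  by apply: cont; exact: nbhs_interior.
move=> /nbhs_ballP[r /= r0 rK]; exists (r / 2); first by rewrite divr_gt0.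
apply: rK; rewrite -ball_normE /= sub0r normrN gtr0_norm ?divr_gt0//.
by rewrite ltr_pdivrMr// ltr_pMr// ltr1n.
Qed.

(** An interior point is an order unit: divide [e - t *: y] by [t]. *)
Lemma interior_absorb e y : interior K e ->
  exists2 t, 0 < t & interior K (t *: e - y).
Proof.
move=> /(interior_ray y)[t t0 Ke]; exists t^-1; first by rewrite invr_gt0.
rewrite -invr_gt0 in t0; have := interior_coneZ t0 Ke.
by rewrite scalerBr scalerA mulVf ?scale1r// gt_eqF// -invr_gt0.
Qed.

(** [0] is the limit of [t *: k] as [t] decreases to [0]. *)
Lemma closed_cone0 : closed K -> K !=set0 -> K 0.
Proof.
move=> cK [k Kk].
apply: (closed_cvg (F := (0 : R^o)^'+) (u_ := fun t => t *: k) K cK).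
  case: K_cone => coneK _; near=> t.
  by apply: coneK => //; near: t; exact: nbhs_right_gt.
rewrite -[X in _ --> X](scale0r k).
apply: (@continuous2_cvg _ _ _ _ _ _ _ _ (fun (u : R^o) (v : Y) => u *: v)).
- exact: (@scale_continuous R Y (0, k)).
- exact: (@cvg_within_filter _ _ _ _ _ _ _ cvg_id).
- exact: cvg_cst.
Unshelve. all: by end_near.
Qed.


End convex_cone.

(** * Continuous linear forms below a convex set *)

Section convex_minorant.
Context (R : realType) (Z : tvsType R).

(** An upper bound on [V] bounds the absolute value of [l] on the symmetric neighborhood formed by
    [V] and its opposite; scaling that neighborhood gives continuity. *)
Lemma scalar_continuousZ (Y : tvsType R) (l : Z -> R) (V : set Z) (c : R)
    (e : Y) : scalar l -> nbhs 0 V -> (forall z, V z -> l z <= c) ->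
  continuous (fun z => l z *: e).
Proof.
move=> lin_l V0 lc z.
have l0 : l 0 = 0 by have := lin_l (-1) 0 0; rewrite scaler0 addr0; lra.
have lZ a x : l (a *: x) = a * l x.
  by have := lin_l a x 0; rewrite l0 !addr0.
have c0 : 0 <= c by rewrite -l0; apply: lc; exact: nbhs_singleton V0.
suff cl : (l x : R^o) @[x --> z] --> (l z : R^o).
  apply: (@continuous2_cvg _ _ _ _ _ _ _ _ (fun (u : R^o) (v : Y) => u *: v)).
  - exact: (@scale_continuous R Y (l z, e)).
  - exact: cl.
  - exact: cvg_cst.
apply/cvgrPdist_lt => eps eps0.
(* With [c + 1] the divisor is positive even if [c = 0], and the final estimate is strict. *)
pose d := eps / (c + 1).
have d0 : 0 < d by rewrite divr_gt0// ltr_wpDl.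
pose V' := V `&` [set - x | x in V].
have V'0 : nbhs 0 V' by apply: filterI => //; exact: nbhs0N.
have := nbhsT z (nbhs0Z (lt0r_neq0 d0) V'0); apply: filterS.
move=> _ [_ [v [Vv [w Vw wv]] <-] <-].
have -> : l (z + d *: v) = l z + d * l v.
  by rewrite addrC lin_l addrC.
rewrite opprD addNKr normrN normrM gtr0_norm// /d mulrAC ltr_pdivrMr; last first.
  by rewrite ltr_wpDl.
rewrite ltr_pM2l// (@le_lt_trans _ _ c) ?ltrDl// ler_norml lc// andbT.
by rewrite lerNl -mulN1r -lZ scaleN1r -wv opprK lc.
Qed.

Lemma convex_setD (E : lmodType R) (A : set E) : convex_set A ->
  forall (a b : R) x y, 0 <= a -> 0 <= b -> A x -> A y ->
    exists2 z, A z & a *: x + b *: y = (a + b) *: z.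
Proof.
move=> /convex_setP cA a b x y a0 b0 Ax Ay.
have [ab0|ab0] := eqVneq (a + b) 0.
  have [a0' b0'] : a = 0 /\ b = 0 by split; lra.
  by exists x; rewrite // a0' b0' addr0 !scale0r addr0.
exists ((a / (a + b)) *: x + (b / (a + b)) *: y).
  apply: cA => //; first by rewrite divr_ge0// addr_ge0.
    by rewrite divr_ge0// addr_ge0.
  by rewrite -mulrDl divff.
by rewrite scalerDr !scalerA !(mulrC (a + b)) !divfK.
Qed.

(* The cone generated by [H] and [U `*` [set c]], with [U] a convex
   neighborhood of [0] in [V], contains no [(0, s)] with [s < 0]. *)
Lemma convex_minorant (H : set (Z * R^o)) (W V : set Z) (c : R) :
    convex_set H -> (forall r, H (0, r) -> 0 <= r) ->
    (forall z r, H (z, r) -> W z) -> W 0 ->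
    (forall a z, W z -> W (a *: z)) ->
    nbhs 0 V -> (forall z, V z -> W z -> H (z, c)) ->
  exists l : Z -> R, [/\ scalar l,
    exists2 U, nbhs 0 U & forall z, U z -> l z <= c &
    forall z r, H (z, r) -> l z <= r].
Proof.
move=> cH H_ge0 HW W0 WZ V0 VH.
have [B Bconvex [Bopen Bbasis]] := @locally_convex R Z.
have [U [BU U0] UV] := Bbasis 0 V V0.
have cU : convex_set U by apply: Bconvex; rewrite inE.
have nU : nbhs 0 U by apply: open_nbhs_nbhs; split => //; exact: Bopen.
have H0c : H (0, c) by apply: VH => //; exact: UV.
have c0 : 0 <= c := H_ge0 _ H0c.
pose G := [set p : Z * R | exists t m h u,
  [/\ 0 <= t, 0 <= m, H h, U u & p = (t *: h.1 + m *: u, t * h.2 + m * c)]].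
have [|z|l [lin_l lG]] := @nonneg_cone_minorant R Z G.
- split.
  + by exists 0, 0, (0, c), 0; rewrite !scale0r !mul0r !addr0.
  + move=> _ _ _ _ [t [m [h [u [t0 m0 Hh Uu [-> ->]]]]]]
      [t' [m' [h' [u' [t'0 m'0 Hh' Uu' [-> ->]]]]]].
    have [g Hg [g1 g2]] := convex_setD cH t0 t'0 Hh Hh'.
    have [v Uv vE] := convex_setD cU m0 m'0 Uu Uu'.
    exists (t + t'), (m + m'), g, v; split; rewrite ?addr_ge0//.
    congr pair; first by rewrite -g1 -vE addrACA.
    by rewrite -[(t + t') * _]g2 addrACA -mulrDl.
  + move=> a _ _ a0 [t [m [h [u [t0 m0 Hh Uu [-> ->]]]]]].
    exists (a * t), (a * m), h, u; split; rewrite ?mulr_ge0// 1?ltW//.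
    by rewrite scalerDr !scalerA mulrDr !mulrA.
  + move=> _ [t [m [h [u [t0 m0 Hh Uu [/eqP + ->]]]]]].
    rewrite eq_sym => /eqP tm0.
    (* If [m] is nonzero, [tm0] makes [u] a multiple of [h.1], hence a point of [W], and [VH]
       applies to it; if [m = 0], the point [0] serves. *)
    have [v Hv mv] : exists2 v, H (v, c) & m *: v = m *: u.
      have [->|mN0] := eqVneq m 0; first by exists 0; rewrite ?scale0r.
      exists u => //; apply: VH; first exact: UV.
      suff -> : u = - (m^-1 * t) *: h.1 by apply/WZ/(HW _ h.2); case: (h) Hh.
      apply/eqP; rewrite scaleNr -addr_eq0 -scalerA -[X in X + _]scale1r.
      by rewrite -(mulVf mN0) -scalerA -scalerDr addrC tm0 scaler0.
    have [[w q] Hwq [w0 q0]] := convex_setD cH t0 m0 Hh Hv.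
    rewrite [leRHS]q0; rewrite mv tm0 in w0.
    have [->|tmN0] := eqVneq (t + m) 0; first by rewrite scale0r.
    apply: mulr_ge0; first exact: addr_ge0.
    move/esym/eqP : w0; rewrite scaler_eq0 (negPf tmN0) => /eqP w0.
    by apply: H_ge0; rewrite -w0.
(* The neighborhood [U] absorbs [z], so the generators [(s *: z, c)] already reach every fibre. *)
- have [s s0 /interior_subset] := @interior_ray R Z U 0 (- z) nU.
  rewrite sub0r -scalerN opprK => Usz.
  exists (s^-1 * c), 0, s^-1, (0, c), (s *: z); split => //.
    by rewrite invr_ge0 ltW.
  by rewrite scale0r mul0r !add0r scalerA mulVf ?scale1r// lt0r_neq0.
exists l; split => //.
  exists U => // z Uz; apply: lG; exists 0, 1, (0, c), z; split => //.
  by rewrite scale0r mul0r scale1r mul1r !add0r.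
move=> z r Hzr; apply: lG; exists 1, 0, (z, r), 0; split => //.
by rewrite scale0r mul0r scale1r mul1r !addr0.
Qed.

End convex_minorant.

(** * Epigraphs of weak suprema *)

Section weak_supremum.
Context (R : realType) (Y : tvsType R) (K : set Y).

Lemma leK_fin (u v : Y) : leK K u%:E v%:E <-> K (v - u).
Proof.
split=> [[k Kk kE]|Kvu]; first by rewrite -opprB -kE opprK.
by exists (v - u) => //; rewrite opprB.
Qed.

Lemma ltK_fin (u v : Y) : ltK K u%:E v%:E <-> interior K (v - u).
Proof.
split=> [[k Kk kE]|Kvu]; first by rewrite -opprB -kE opprK.
by exists (v - u) => //; rewrite opprB.
Qed.

Context (K_cone : convex_cone K) (K_closed : closed K).
Context (K_int : interior K !=set0).

Lemma closed_convex_coneZ t x : 0 <= t -> K x -> K (t *: x).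
Proof.
rewrite le_eqVlt => /predU1P[<- Kx|t0 Kx].
  by rewrite scale0r; apply: closed_cone0 => //; exists x.
by case: K_cone => coneK _; exact: coneK.
Qed.

(* On the ray [y - t *: e] with [e] interior to [K], the last point that is
   strictly below no element of [M] is a weak supremum of [M]. *)
Lemma addK_WSup (M : set (\bar Y)) (y : Y) : ~ M +oo%E ->
    (exists w, M w%:E) ->
  addK K (WSup K M) y%:E <-> forall w, M w%:E -> ~ interior K (w - y).
Proof.
move=> Moo [w0 Mw0]; split.
  move=> [[v| |] [vM _] [k Kk]] //= [vkE] w Mw Kwy.
  apply: (vM _ Mw); apply/ltK_fin.
  have -> : w - v = k + (w - y) by rewrite -vkE opprD addrCA [k + _]addrCA subrr addr0.
  exact: interior_coneD.
move=> yM; case: K_int => e Ke.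
have mono a s t : s <= t -> interior K (a + s *: e) -> interior K (a + t *: e).
  move=> st Kas; have -> : a + t *: e = (t - s) *: e + (a + s *: e).
    by rewrite addrCA -scalerDl subrK.
  apply: interior_coneD => //; apply: closed_convex_coneZ.
    by rewrite subr_ge0.
  exact: interior_subset.
pose P := [set t | 0 <= t /\
  forall w, M w%:E -> ~ interior K (w - y + t *: e)].
have P0 : P 0 by split=> // w Mw; rewrite scale0r addr0; exact: yM.
have supP : has_sup P.
  split; first by exists 0.
  (* The single element [w0] bounds [P]: past [c] it lies strictly above the ray. *)
  have [c _ Kc] := interior_absorb K_cone (y - w0) Ke.
  exists c => t [t0 tM]; rewrite leNgt; apply/negP => ct.
  apply: (tM _ Mw0); apply: (mono _ c); first exact: ltW.
  by rewrite -opprB addrC.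
pose t := sup P.
have t0 : 0 <= t by apply: ub_le_sup => //; case: supP.
exists (y - t *: e)%:E; last first.
  exists (t *: e); last exact: (congr1 EFin (subrK _ _)).
  by apply: closed_convex_coneZ => //; exact: interior_subset.
split.
  move=> [w Mw|/Moo[]|_ []].
  move=> /ltK_fin; rewrite opprB addrCA => Kw.
  (* The slack [d] makes even [t - d] inadmissible, although some member of [P] exceeds it. *)
  have [d d0 Kd] := interior_ray e Kw.
  have [s [s0 sM] ts] := sup_adherent d0 supP.
  apply: (sM _ Mw); apply: (mono _ (t - d)); first exact: ltW.
  by rewrite scalerBl addrA [w - y + _]addrC.
move=> [u|[]|_]; last by exists w0%:E.
move=> /ltK_fin Ku; have [d d0 Kd] := interior_ray e Ku.
(* Since [t + d] exceeds the supremum, some [w] violates the condition there; the slack [d] below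
   the candidate pays for this excess. *)
have [w Mw Kw] : exists2 w, M w%:E & interior K (w - y + (t + d) *: e).
  apply: contrapT => nw.
  have /(ub_le_sup (proj2 supP)) : P (t + d).
    by split=> [|w Mw Kw]; [rewrite addr_ge0// ltW|apply: nw; exists w].
  by rewrite -/t leNgt ltrDl d0.
exists w%:E => //; apply/ltK_fin.
have -> : w - u = (y - t *: e - u - d *: e) + (w - y + (t + d) *: e).
  rewrite scalerDl [RHS](AC (4*(2*2)) ((5*3)*(1*6)*(2*7)*(4*8)))/=.
  by rewrite subrr !addNr !addr0.
by apply: interior_coneD => //; exact: interior_subset.
Qed.

(** Where [f] is [+oo] the difference is [-oo], which is strictly above nothing, so only finite
    values of [f] constrain [y]. *)
Lemma addK_WSup_range (T : Type) (g : T -> Y) (f : T -> \bar Y) (y : Y) :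
    (forall t, f t <> -oo%E) -> effdom f !=set0 ->
  addK K (WSup K (range (fun t => (g t)%:E - f t)%E)) y%:E <->
  forall t r, f t = r%:E -> ~ interior K (g t - r - y).
Proof.
move=> f_fin [t0 ft0].
have [r0 fE] : exists r, f t0 = r%:E.
  move: ft0 (f_fin t0); rewrite /effdom /=.
  by case: (f t0) => [r _ _|[]|_ []]//; exists r.
rewrite addK_WSup; last 2 first.
- by move=> [t _]; case: (f t) (f_fin t).
- by exists (g t0 - r0), t0 => //; rewrite fE.
split=> [h t r ftE|h w [t _]].
  by apply: h; exists t => //; rewrite ftE.
case ftE : (f t) => [r| |]//= [<-]; exact: h ftE.
Qed.

End weak_supremum.

(** * Construction of the multiplier *)

Section conjugate_epigraph.
Context (R : realType) (X Y Z : tvsType R) (K : set Y).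
Context (K_closed : closed K) (K_cone : convex_cone K).
Context (K_int : interior K !=set0).

(** Collects what [convex_minorant] asks of the subspace [W]. *)
Lemma linP (E : lmodType R) (A : set E) :
  [/\ A `<=` lin A, lin A 0 & forall a z, lin A z -> lin A (a *: z)].
Proof.
split.
- by move=> z Az W [_ AW]; exact: AW.
- by move=> W [[W0 _] _]; move: W0; rewrite inE.
- move=> a z lz W [[W0 Wlin] AW].
  have := Wlin a z 0; rewrite addr0 !inE; apply; last by move: W0; rewrite inE.
  by apply: lz; split.
Qed.

(* [H] is the epigraph of [z |-> inf_x s(Phi(x, z) - L x + y)], where
   [s u = inf {r | r *: e - u \in K}] is the Gerstewitz functional of [K]. *)
Lemma exists_multiplier (Phi : X * Z -> \bar Y) (L : contLinearType X Y)
    (y yL : Y) (V : set Z) : K_convex K Phi ->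
    (forall p, Phi p <> -oo%E) -> nbhs (0 : Z) V ->
    (forall z, (V `&` lin (snd @` effdom Phi)) z ->
        exists x, leK K (Phi (x, z) - (L x)%:E)%E yL%:E) ->
    (forall x r, Phi (x, 0) = r%:E -> ~ interior K (L x - r - y)) ->
  exists T : contLinearType Z Y,
    (forall p r, Phi p = r%:E -> ~ interior K (L p.1 + T p.2 - r - y)) /\
    (forall S : set Z, cone S ->
      (exists x, effdom Phi (x, 0) /\
        forall z, (-%R @` S) z -> leK K (Phi (x, z)) (Phi (x, 0))) ->
      L_plus K S T).
Proof.
move=> /convex_setP cPhi Phi_fin V0 hV h0.
have [e eK] := K_int.
have Ke : K e := interior_subset eK.
have K0 : K 0 by apply: closed_cone0 => //; exists e.
have KD := convex_coneD K_cone.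
have KZ := closed_convex_coneZ K_cone K_closed.
pose H := [set p : Z * R^o | exists x r, Phi (x, p.1) = r%:E /\
  K (L x + p.2 *: e - r - y)].
have [linS lin0 linZ] := linP (snd @` effdom Phi).
(* This [c] turns the bound [yL] into membership of [(z, c)] in [H] for all [z] of the hull in
   [V]. *)
have [c _ /interior_subset Kc] := interior_absorb K_cone (yL + y) eK.
have [||z r||||z Vz lz|l [lin_l [U U0 lU] lH]] := @convex_minorant R Z H
    (lin (snd @` effdom Phi)) V c.
- apply/convex_setP => a b [z1 s1] [z2 s2] a0 b0 ab1.
  move=> [x1 [r1 [/= Phi1 K1]]] [x2 [r2 [/= Phi2 K2]]].
  have := cPhi a b (x1, z1, r1) (x2, z2, r2) a0 b0 ab1.
  case.
  + by exists r1%:E; [rewrite /= Phi1|exists 0; rewrite //= addr0].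
  + by exists r2%:E; [rewrite /= Phi2|exists 0; rewrite //= addr0].
  move=> _ /= -> [k Kk]; case PhiE : (Phi _) => [r| |]//= [rk].
  exists (a *: x1 + b *: x2), r; split => //=.
  have rE : r = a *: r1 + b *: r2 - k by rewrite -rk addrK.
  have -> : L (a *: x1 + b *: x2) + (a *: s1 + b *: s2) *: e - r - y =
      a *: (L x1 + s1 *: e - r1 - y) + b *: (L x2 + s2 *: e - r2 - y) + k.
    rewrite linearD !linearZ /= scalerDl -!scalerA rE !opprD opprK.
    rewrite -[in LHS](scale1r y) -ab1 scalerDl opprD !scalerDr !scalerN.
    by rewrite [LHS](AC (2*2*3*2) ((1*3*5*8)*(2*4*6*9)*7))/=.
  exact: (KD _ _ (KD _ _ (KZ _ _ a0 K1) (KZ _ _ b0 K2)) Kk).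
(* For [r < 0], adding the interior vector [- r *: e] would push [L x - rho - y] into the interior,
   against [h0]. *)
- move=> r [x [rho [/= PhiE Kr]]]; rewrite leNgt; apply/negP => r0.
  apply: (h0 _ _ PhiE).
  have -> : L x - rho - y = (L x + r *: e - rho - y) + (- r) *: e.
    rewrite scaleNr [RHS](AC (4*1) ((1*3*4)*(2*5)))/=.
    by rewrite subrr addr0.
  apply: interior_coneD => //; apply: interior_coneZ => //.
  by rewrite oppr_gt0.
- by move=> [x [rho [/= PhiE _]]]; apply: linS; exists (x, z); rewrite // /effdom/= PhiE.
- by [].
- by [].
- by [].
- have [x] := hV z (conj Vz lz).
  case PhiE : (Phi (x, z)) (Phi_fin (x, z)) => [r| |]//= _ /leK_fin Kr.
  exists x, r; split => //=.
  have -> : L x + c *: e - r - y = (c *: e - (yL + y)) + (yL - (r - L x)).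
    rewrite !opprD opprK [RHS](AC ((1*2)*(1*2)) ((6*1*5*3)*(4*2)))/=.
    by rewrite subrr addr0.
  exact: KD.
have cT := scalar_continuousZ (e := e) lin_l U0 lU.
have lT : linear (fun z => l z *: e).
  by move=> a u v; rewrite lin_l scalerDl scalerA.
pose T : contLinearType Z Y := HB.pack (fun z => l z *: e)
  (isContinuous.Build Z Y (fun z => l z *: e) cT)
  (GRing.isLinear.Build R Z Y *:%R (fun z => l z *: e) lT).
have l0 : l 0 = 0 by have := lin_l (-1) 0 0; rewrite scaler0 addr0; lra.
have lZ a x : l (a *: x) = a * l x.
  by have := lin_l a x 0; rewrite l0 !addr0.
exists T; split.
  (* An interior value would leave room to lower the height by [d], putting [(z, l z - d)] in [H],
     below [l]. *)
  move=> [x z] r PhiE /= /(interior_ray e)[d d0 /interior_subset Kd].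
  suff : l z <= l z - d by rewrite leNgt ltrBlDr ltrDl d0.
  apply: lH; exists x, r; split=> //=.
  by rewrite scalerBl [L x + _ - r - y](AC (1*2*1*1) ((1*2*4*5)*3))/=.
move=> S coneS [x []]; rewrite /effdom /=.
case Phi0 : (Phi (x, 0)) (Phi_fin (x, 0)) => [r0| |]//= _ _ hS _ [s Ss <-].
apply: KZ => //; rewrite leNgt; apply/negP => ls.
(* The height [b] depends only on the value at [(x, 0)], so it serves all points [- (t *: s)] at
   once. *)
have [b b0 /interior_subset Kb] := interior_absorb K_cone (r0 + (y - L x)) eK.
have lb t : 0 < t -> - (t * l s) <= b.
  move=> t0; rewrite -mulN1r -lZ -lZ scaleN1r; apply: lH.
  have := hS (- (t *: s)) (ex_intro2 _ _ _ (coneS _ _ t0 Ss) erefl).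
  case PhiE : (Phi _) (Phi_fin (x, - (t *: s))) => [r| |]//= _ /leK_fin Kr.
  exists x, r; split=> //=.
  have -> : L x + b *: e - r - y = (b *: e - (r0 + (y - L x))) + (r0 - r).
    rewrite opprD opprB [RHS](AC ((1*(1*2))*2) ((3*1*6*4)*(5*2)))/=.
    by rewrite subrr addr0.
  exact: KD.
(* This choice of [t] makes the left side [b + 1]. *)
have := lb ((b + 1) / - l s); rewrite divr_gt0 ?oppr_gt0 ?addr_gt0//.
rewrite invrN mulrN mulNr opprK divfK ?ltr0_neq0// => /(_ isT).
by rewrite leNgt ltrDl ltr01.
Qed.

End conjugate_epigraph.

(** * Equality of the epigraphs *)

Theorem theorem3p1 (R : realType) (X Y Z : tvsType R)
    (hX : hausdorff_space X) (hY : hausdorff_space Y) (hZ : hausdorff_space Z)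
    (K : set Y) (K_proper : K <> [set: Y]) (K_closed : closed K)
    (K_cone : convex_cone K) (K_int : interior K !=set0)
    (S : set Z) (S_neq0 : S !=set0) (S_cone : convex_cone S)
    (Phi : X * Z -> \bar Y) (Phi_fin : forall p, Phi p <> -oo%E)
    (Phi_proper : proper_fun Phi) (Phi_convex : K_convex K Phi)
    (Phi_0 : (snd @` effdom Phi) 0) :
  (forall L : contLinearType X Y, exists (yL : Y) (V : set Z),
      nbhs (0 : Z) V /\
      forall z, (V `&` lin (snd @` effdom Phi)) z ->
        exists x : X, leK K (Phi (x, z) - (L x)%:E)%E yL%:E) ->
  epi K (weak_conj K (fun x => Phi (x, 0))) =
    \bigcup_(T in L_Phi K Phi) epi K (fun L => weak_conj2 K Phi L T) /\
  ((exists x : X, effdom Phi (x, 0) /\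
      forall z, (-%R @` S) z -> leK K (Phi (x, z)) (Phi (x, 0))) ->
   epi K (weak_conj K (fun x => Phi (x, 0))) =
     \bigcup_(T in L_Phi K Phi) epi K (fun L => weak_conj2 K Phi L T) /\
   \bigcup_(T in L_Phi K Phi) epi K (fun L => weak_conj2 K Phi L T) =
     \bigcup_(T in L_Phi_plus K Phi S) epi K (fun L => weak_conj2 K Phi L T)).
Proof.
move=> hyp1.
have Phi_0' : effdom (fun x => Phi (x, 0)) !=set0.
  by case: Phi_0 => [[x z] /= dz z0]; exists x; rewrite /effdom /= -z0.
have epiP p : epi K (weak_conj K (fun x => Phi (x, 0))) p <->
    forall x r, Phi (x, 0) = r%:E -> ~ interior K (p.1 x - r - p.2).
  exact: addK_WSup_range.
have epi2P T p : epi K (fun L => weak_conj2 K Phi L T) p <->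
    forall q r, Phi q = r%:E -> ~ interior K (p.1 q.1 + T q.2 - r - p.2).
  exact: (@addK_WSup_range _ _ _ _ _ _ _ (fun q => p.1 q.1 + T q.2)).
have epi2_sub T p : epi K (fun L => weak_conj2 K Phi L T) p ->
    epi K (weak_conj K (fun x => Phi (x, 0))) p.
  move=> /epi2P h; apply/epiP => x r /h /=.
  by rewrite linear0 addr0.
(* A finite [p.2] cannot arise from [+oo], so a nonempty epigraph already places [T] in [L_Phi]. *)
have epi2_L_Phi T p : epi K (fun L => weak_conj2 K Phi L T) p -> L_Phi K Phi T.
  by move=> [v Wv [k _ vk]]; exists p.1 => Woo; move: Wv vk; rewrite Woo => ->.
(* One operator serves both parts; its positivity on [S] is kept conditional on the second
   hypothesis. *)
have mult p : epi K (weak_conj K (fun x => Phi (x, 0))) p -> exists T,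
    epi K (fun L => weak_conj2 K Phi L T) p /\
    ((exists x : X, effdom Phi (x, 0) /\
      forall z, (-%R @` S) z -> leK K (Phi (x, z)) (Phi (x, 0))) ->
    L_plus K S T).
  move=> /epiP hp; have [yL [V [V0 hV]]] := hyp1 p.1.
  have [T [Tp TS]] :=
    exists_multiplier K_closed K_cone K_int Phi_convex Phi_fin V0 hV hp.
  by exists T; split; [exact/epi2P|apply: TS; case: S_cone].
have eq1 : epi K (weak_conj K (fun x => Phi (x, 0))) =
    \bigcup_(T in L_Phi K Phi) epi K (fun L => weak_conj2 K Phi L T).
  apply/seteqP; split=> p; last by move=> [T _]; exact: epi2_sub.
  by move=> /mult[T [Tp _]]; exists T => //; exact: epi2_L_Phi Tp.
split=> // hyp2; split=> //; apply/seteqP; split=> p; last first.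
  by move=> [T [LT _] Tp]; exists T.
rewrite -eq1 => /mult[T [Tp TS]]; exists T => //.
by split; [exact: epi2_L_Phi Tp|exact: TS].
Qed.
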